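(* Let $r>0$ and let $K$ be a negative binomial random variable with parameter $p\in(0,1)$, i.e. $\Pr\{K=k\}=\binom{k+r-1}{k}p^r(1-p)^k$ for $k=0,1,2,\dots$. Let $[a,b]\subset(0,1)$. Suppose that both $L(k)$ and $U(k)$ are monotone functions of the non-negative integer $k$. Then the minimum of $\Pr\{L(K)<p<U(K)\mid p\}$ with respect to $p\in[a,b]$ is attained at the discrete set $$\{a,b\}\cup\{L(k)\in(a,b):k\ge0\}\cup\{U(k)\in(a,b):k\ge0\}.$$
   Context: $\Pr\{E\mid p\}$ denotes the probability of $E$ when the parameter has value $p$, with $r$ fixed (not a conditional probability). $L$ and $U$ are real-valued functions of $k$ not depending on $p$. ''Monotone'' means either non-decreasing or non-increasing; $L$ and $U$ need not be monotone in the same direction. *)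

(* Defs.v *)
From HB Require Import structures.
From mathcomp Require Import all_boot all_order all_algebra.
From mathcomp Require Import all_classical all_reals all_analysis.
Set Implicit Arguments.
Unset Strict Implicit.
Unset Printing Implicit Defensive.
Import Order.TTheory GRing.Theory Num.Theory.
Import numFieldNormedType.Exports.

Local Open Scope classical_set_scope.
Local Open Scope ring_scope.

(* x (x - 1) ... (x - k + 1) / k!, so that the negative binomial parameter r
   may be any positive real; it is 'C(n, k) when x = n%:R *)
Definition gen_binomial (R : realType) (x : R) (k : nat) : R :=
  (\prod_(i < k) (x - i%:R)) / k`!%:R.

Definition negative_binomial_pmf (R : realType) (r p : R) (k : nat) : R :=
  gen_binomial (k%:R + r - 1) k * p `^ r * (1 - p) ^+ k.

Definition is_negative_binomial (R : realType) (d : measure_display)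
    (T : measurableType d) (P : probability T R) (K : {RV P >-> nat})
    (r p : R) : Prop :=
  forall k : nat, P (K @^-1` [set k]) = (negative_binomial_pmf r p k)%:E.

Definition coverage (R : realType) (d : measure_display)
    (T : measurableType d) (P : probability T R) (K : {RV P >-> nat})
    (L U : nat -> R) (p : R) : \bar R :=
  P [set t | L (K t) < p < U (K t)].

Definition monotone_seq (R : realType) (u : nat -> R) : Prop :=
  nondecreasing_seq u \/ nonincreasing_seq u.

(* Main.v *)
Require Import Defs.
From HB Require Import structures.
From mathcomp Require Import all_boot all_order all_algebra.
From mathcomp Require Import all_classical all_reals all_analysis.
From mathcomp Require Import ring lra zify.
Import Order.TTheory GRing.Theory Num.Theory.
Import numFieldNormedType.Exports.

Local Open Scope classical_set_scope.
Local Open Scope ring_scope.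

(* Write S(p) for the set of k with L(k) < p < U(k); by monotonicity of L and U
   it is an interval of integers.  For a fixed interval I, the probability
   P_p(K in I) is quasi-concave in p: for x < y < z some nonnegative combination
   of the mass functions at x and z is at most the mass function at y on I and at
   least it off I, and summing over I and over its complement gives
   min(P_x(I), P_z(I)) <= P_y(I).
   If q1 is the last point of {a} and the values of U that is at most p, and q2
   the first point of {b} and the values of L that is at least p, then S(q1) and
   S(q2) are contained in S(p), so the coverage at q1 or at q2 is at most the
   coverage at p.  (When q1 or q2 does not exist, because the values accumulate,
   S is empty at b or at a.)  As the values of L and U may accumulate in [a, b],
   a minimum over [a, b] must be known to exist: it does, since the coverage is a
   sum of continuous functions times indicators of open sets, hence lower
   semicontinuous. *)

(** * Convex sequences and intervals of integers *)

(** As the increments are nondecreasing, one ascent persists at all later indices and one descent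
    holds at all earlier ones. Equal values at [m] and [n] force a descent at [m] and an ascent just
    before [n]. *)
Lemma convex_seq_sublevel (R : realFieldType) (phi : nat -> R) (c : R)
    (m n : nat) :
  (forall i, phi i.+1 - phi i <= phi i.+2 - phi i.+1) -> (m < n)%N ->
  phi m = c -> phi n = c ->
  forall k, if (m <= k < n)%N then phi k <= c else c <= phi k.
Proof.
move=> slope1 mn phim phin.
have slope i j : (i <= j)%N -> phi i.+1 - phi i <= phi j.+1 - phi j.
  elim: j => [|j IH]; first by rewrite leqn0 => /eqP->.
  by rewrite leq_eqVlt => /predU1P[->//|/IH] /le_trans; apply.
have asc k i j : phi k <= phi k.+1 -> (k <= i)%N -> (i <= j)%N ->
    phi i <= phi j.
  move=> hk ki; elim: j => [|j IH]; first by rewrite leqn0 => /eqP->.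
  rewrite leq_eqVlt => /predU1P[->//|ij].
  have := slope k j (leq_trans ki ij); have := IH ij; lra.
have desc k i j : phi k.+1 <= phi k -> (i <= j)%N -> (j <= k.+1)%N ->
    phi j <= phi i.
  move=> hk; elim: j => [|j IH]; first by rewrite leqn0 => /eqP->.
  rewrite leq_eqVlt => /predU1P[->//|ij] jk.
  have := slope j k jk; have := IH ij (ltnW jk); lra.
have dm : phi m.+1 <= phi m.
  rewrite leNgt; apply/negP => h.
  by have := asc m m.+1 n (ltW h) (leqnSn m) mn; lra.
have dn : phi n.-1 <= phi n.
  rewrite leNgt; apply/negP => h; case: n => [//|n] in mn phin h *.
  by have := desc n m n (ltW h) mn (leqnSn n); lra.
move=> k; case: ifPn => [/andP[mk kn]|].
  have [h|h] := leP (phi k) (phi k.+1).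
    by rewrite -phin; apply: (asc k) => //; apply: ltnW.
  by rewrite -phim; apply: (desc k) => //; apply: ltW.
rewrite negb_and -ltnNge -leqNgt => /orP[km|nk].
  by rewrite -phim; apply: (desc m) => //; apply: ltnW.
by rewrite -phin; apply: (asc n.-1) => //; rewrite ?prednK ?leq_pred//; lia.
Qed.

Definition order_convex (I : set nat) : Prop :=
  forall i j k, (i <= j <= k)%N -> I i -> I k -> I j.

(** Here [m] is the least element of [I] and [n] the first integer from [m] on that lies outside
    [I], if there is one. *)
Lemma order_convexP (I : set nat) : order_convex I ->
  [\/ I = set0, exists m, I = [set k | (m <= k)%N] |
      exists m n, (m < n)%N /\ I = [set k | (m <= k < n)%N]].
Proof.
move=> cI.
have [[i Ii]|I0] := pselect (exists i, I i); last first.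
  by apply: Or31; rewrite -subset0 => i Ii; apply: I0; exists i.
have exI : exists i, `[< I i >] by exists i; apply/asboolP.
case: (ex_minnP exI) => m /asboolP Im mmin.
have [[j [mj nIj]]|nup] := pselect (exists j, (m <= j)%N /\ ~ I j); last first.
  apply: Or32; exists m; apply/seteqP; split => k /=.
    by move=> /asboolP; apply: mmin.
  by move=> mk; apply: contrapT => nIk; apply: nup; exists k.
have exJ : exists j, (m <= j)%N && ~~ `[< I j >].
  by exists j; rewrite mj; apply/asboolP.
case: (ex_minnP exJ) => n /andP[mn /asboolP nIn] nmin.
have {}mn : (m < n)%N.
  by rewrite ltn_neqAle mn andbT; apply/eqP => mn'; rewrite mn' in Im.
apply: Or33; exists m, n; split=> //; apply/seteqP; split => k /=.
  move=> Ik; rewrite (mmin k (introT (asboolP _) Ik))/= ltnNge.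
  by apply/negP => nk; apply/nIn/(cI m n k) => //; rewrite nk (ltnW mn).
move=> /andP[mk kn]; apply: contrapT => nIk.
move: kn; rewrite ltnNge => /negP; apply; apply: nmin.
by rewrite mk; apply/asboolP.
Qed.

(* In [k], the function [A X^k + B Z^k] divided by [Y^k] is convex, so it can be
   made to cross [1] exactly at the two ends of [I]. *)
Lemma geometric_separation (R : realFieldType) (X Y Z : R) (I : set nat) :
  0 < Z -> Z < Y -> Y < X -> order_convex I ->
  exists A B, [/\ 0 <= A, 0 <= B,
    forall k, I k -> A * X ^+ k + B * Z ^+ k <= Y ^+ k &
    forall k, ~ I k -> Y ^+ k <= A * X ^+ k + B * Z ^+ k].
Proof.
move=> Z0 ZY YX cI.
have Y0 : 0 < Y by lra.
pose u := X / Y; pose w := Z / Y.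
have u1 : 1 < u by rewrite ltr_pdivlMr// mul1r.
have w1 : w < 1 by rewrite ltr_pdivrMr// mul1r.
have w0 : 0 < w by rewrite divr_gt0.
suff [A [B [A0 B0 inI outI]]] : exists A B, [/\ 0 <= A, 0 <= B,
    forall k, I k -> A * u ^+ k + B * w ^+ k <= 1 &
    forall k, ~ I k -> 1 <= A * u ^+ k + B * w ^+ k].
  have E k : A * X ^+ k + B * Z ^+ k = (A * u ^+ k + B * w ^+ k) * Y ^+ k.
    by rewrite mulrDl -!mulrA -!exprMn /u /w !divfK// gt_eqF.
  exists A, B; split=> // k Ik; rewrite E.
    by rewrite ler_piMl ?inI// exprn_ge0 ?ltW//.
  by rewrite ler_peMl ?outI// exprn_ge0 ?ltW//.
have [I0|[m Im]|[m [n [mn Imn]]]] := order_convexP _ cI.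
(* For empty or unbounded [I] one geometric sequence is enough: the growing one, or the decaying one
   scaled to equal 1 at [m]. *)
- exists 1, 0; split=> // k; rewrite I0//= => _.
  by rewrite mul1r mul0r addr0 exprn_ege1 ?ltW//.
- have wm0 : 0 < w ^+ m by rewrite exprn_gt0.
  exists 0, (w ^+ m)^-1; rewrite invr_ge0 (ltW wm0); split=> // k; rewrite Im/=.
    move=> mk; rewrite mul0r add0r mulrC ler_pdivrMr// mul1r.
    by apply: ler_wiXn2l => //; apply: ltW.
  move=> /negP; rewrite -ltnNge => km.
  rewrite mul0r add0r mulrC ler_pdivlMr// mul1r.
  by apply: ler_wiXn2l; rewrite ?ltW// ltnW.
have umn : u ^+ m < u ^+ n by rewrite ltr_eXn2l.
have wnm : w ^+ n < w ^+ m by rewrite ltr_iXn2l.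
have um0 : 0 < u ^+ m by rewrite exprn_gt0; lra.
have wn0 : 0 < w ^+ n by rewrite exprn_gt0.
(* [A] and [B] solve the linear system [phi m = phi n = 1] by Cramer's rule; [D] is its determinant
   up to sign. *)
pose D := u ^+ n * w ^+ m - u ^+ m * w ^+ n.
have D0 : 0 < D by rewrite /D; nra.
pose A := (w ^+ m - w ^+ n) / D; pose B := (u ^+ n - u ^+ m) / D.
have A0 : 0 <= A by rewrite divr_ge0//; lra.
have B0 : 0 <= B by rewrite divr_ge0//; lra.
pose phi k := A * u ^+ k + B * w ^+ k.
have phim : phi m = 1 by rewrite /phi /A /B /D; field; rewrite /D in D0; lra.
have phin : phi n = 1 by rewrite /phi /A /B /D; field; rewrite /D in D0; lra.
have sub : forall k, if (m <= k < n)%N then phi k <= 1 else 1 <= phi k.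
  apply: convex_seq_sublevel => // i.
  have Au : 0 <= A * u ^+ i by rewrite mulr_ge0// exprn_ge0//; lra.
  have Bw : 0 <= B * w ^+ i by rewrite mulr_ge0// exprn_ge0//; lra.
  rewrite /phi !exprS -subr_ge0.
  (* The second difference of [phi] is a sum of two nonnegative terms. *)
  rewrite [leRHS](_ : _ = A * u ^+ i * (u - 1) ^+ 2
                          + B * w ^+ i * (w - 1) ^+ 2); last by ring.
  by rewrite addr_ge0// mulr_ge0// sqr_ge0.
exists A, B; split=> // k; rewrite Imn/= => Ik; have := sub k.
  by rewrite Ik.
by move/negP/negbTE : Ik => ->.
Qed.

(** * Minimum of a lower semicontinuous function on a segment *)

(** By compactness a minimising sequence has a cluster point in the segment, and lower
    semicontinuity makes it a minimiser. *)
Lemma attains_min_segment (R : realType) (a b : R) (f : R -> R) (c : R) :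
  a <= b -> (forall x, c <= f x) ->
  (forall x y, a <= x <= b -> y < f x -> \forall z \near x, y < f z) ->
  exists2 x, a <= x <= b & forall y, a <= y <= b -> f x <= f y.
Proof.
move=> ab fc lsc.
pose E := [set f x | x in [set x | a <= x <= b]].
have hE : has_inf E.
  split; first by exists (f a), a => //=; rewrite lexx.
  by exists c => _ [x _ <-].
have /choice[x_ xP] (n : nat) :
    exists x, a <= x <= b /\ f x < inf E + n.+1%:R^-1.
  have [|_ [x abx <-] ?] := @inf_adherent _ E n.+1%:R^-1 _ hE => //.
  by exists x.
have [|x [/=]] := @segment_compact R a b (x_ @ \oo) _.
  by exists 0%N => // n _ /=; rewrite in_itv/=; case: (xP n).
rewrite in_itv/= => abx clx; exists x => // y aby.
suff : f x <= inf E.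
  move/le_trans; apply; apply: ge_inf; first by case: hE.
  by exists y.
rewrite leNgt; apply/negP => lt.
pose e := f x - inf E.
have e0 : 0 < e / 2 by rewrite /e; lra.
(* The first set contains a tail of the sequence, the second is a neighbourhood of [x]; they would
   have to meet. *)
have [] := clx [set z | f z < inf E + e / 2] [set z | inf E + e / 2 < f z].
- have [N _ hN] := near_infty_natSinv_lt (PosNum e0).
  exists N => // n Nn /=; apply: lt_le_trans (xP n).2 _.
  by rewrite lerD2l ltW//; exact: hN.
- by apply: lsc => //; rewrite /e; lra.
by move=> z [/= h1 h2]; lra.
Qed.

(** * Values of a monotone sequence next to a point *)

(** The last clause says that no value of [u] lies in [(q, p]]. The first alternative covers an
    increasing [u] that stays below [p] and may have no largest value. *)
Lemma monotone_last_below (R : realType) (u : nat -> R) (a p : R) :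
  monotone_seq u -> a <= p ->
  (forall k, u k <= p) \/
  exists q, [/\ a <= q <= p, q = a \/ exists k, q = u k &
                forall k, q < u k -> p < u k].
Proof.
move=> mu ap.
have qmax x : x <= p -> (exists k, x = u k) ->
    [/\ a <= Num.max a x <= p & Num.max a x = a \/ exists k, Num.max a x = u k].
  move=> xp ex; rewrite le_max lexx ge_max ap xp; split=> //.
  by have [_|_] := leP a x; [right|left].
case: mu => mu.
  have [exk|nup] := pselect (exists k, p < u k); last first.
    by left=> k; rewrite leNgt; apply/negP => puk; apply: nup; exists k.
  right; case: (ex_minnP exk) => -[|n] pun nmin.
    (* Already [u 0] exceeds [p], hence so does every value, and [a] serves. *)
    exists a; split=> [||k _]; [by rewrite lexx|by left|].
    by apply: lt_le_trans pun _; apply: (mu).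
  have unp : u n <= p.
    by rewrite leNgt; apply/negP => /nmin; rewrite ltnn.
  have [||ab eq] := qmax (u n) => //; first by exists n.
  exists (Num.max a (u n)); split=> // k; rewrite gt_max => /andP[_ h].
  apply: lt_le_trans pun _; apply: (mu); rewrite ltnNge; apply/negP => kn.
  by have := mu _ _ kn; rewrite leNgt h.
right; have [exk|nup] := pselect (exists k, u k <= p); last first.
  exists a; split=> [||k _]; [by rewrite lexx|by left|].
  by rewrite ltNge; apply/negP => h; apply: nup; exists k.
case: (ex_minnP exk) => n unp nmin.
have [||ab eq] := qmax (u n) => //; first by exists n.
exists (Num.max a (u n)); split=> // k; rewrite gt_max => /andP[_ h].
rewrite ltNge; apply/negP => /nmin nk.
by have := mu _ _ nk; rewrite leNgt h.
Qed.

(** * Comparison of probabilities through their point masses *)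

Lemma mass_series (R : realType) (mu : {measure set nat -> \bar R})
    (I : set nat) :
  mu I = (\sum_(0 <= k <oo | k \in I) mu [set k])%E.
Proof.
rewrite -[in LHS](_ : \bigcup_(k in I) [set k] = I); last first.
  by apply/seteqP; split => [k [j Ij ->]|k Ik] //; exists k.
rewrite measure_bigcup//.
by move=> i j _ _ [k [-> ->]].
Qed.

Lemma le_mass_combination (R : realType)
    (mu nu rho : probability nat R) (I : set nat) (A B C : R) :
  0 <= A -> 0 <= B -> 0 <= C ->
  (forall k, I k ->
    A%:E * mu [set k] + B%:E * rho [set k] <= C%:E * nu [set k])%E ->
  (A%:E * mu I + B%:E * rho I <= C%:E * nu I)%E.
Proof.
move=> A0 B0 C0 le; rewrite !(mass_series _ _ I) -!nneseriesZl//.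
rewrite -nneseriesD => [|k _ _|k _ _]; last 2 first.
- by rewrite mule_ge0// lee_fin.
- by rewrite mule_ge0// lee_fin.
apply: lee_nneseries => [k _ _|k /set_mem]; last exact: le.
by rewrite adde_ge0// mule_ge0// lee_fin.
Qed.

Lemma ge_mass_combination (R : realType)
    (mu nu rho : probability nat R) (I : set nat) (A B C : R) :
  0 <= A -> 0 <= B -> 0 <= C ->
  (forall k, I k ->
    C%:E * nu [set k] <= A%:E * mu [set k] + B%:E * rho [set k])%E ->
  (C%:E * nu I <= A%:E * mu I + B%:E * rho I)%E.
Proof.
move=> A0 B0 C0 le; rewrite !(mass_series _ _ I) -!nneseriesZl//.
rewrite -nneseriesD => [|k _ _|k _ _]; last 2 first.
- by rewrite mule_ge0// lee_fin.
- by rewrite mule_ge0// lee_fin.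
apply: lee_nneseries => [k _ _|k /set_mem]; last exact: le.
by rewrite mule_ge0// lee_fin.
Qed.

(* If [A + B >= C] the hypothesis on [I] suffices; otherwise use the one on the
   complement together with [mu I, rho I <= 1]. *)
Lemma min_probability_le (R : realType) (mu nu rho : probability nat R)
    (I : set nat) (A B C : R) :
  0 <= A -> 0 <= B -> 0 < C ->
  (forall k, I k ->
    A%:E * mu [set k] + B%:E * rho [set k] <= C%:E * nu [set k])%E ->
  (forall k, ~ I k ->
    C%:E * nu [set k] <= A%:E * mu [set k] + B%:E * rho [set k])%E ->
  (mu I <= nu I \/ rho I <= nu I)%E.
Proof.
move=> A0 B0 C0 inI outI.
have := le_mass_combination _ mu nu rho _ _ _ _ A0 B0 (ltW C0) inI.
have := ge_mass_combination _ mu nu rho (~` I) _ _ _ A0 B0 (ltW C0) outI.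
rewrite !probability_setC//.
have fin (m : probability nat R) : m I = (fine (m I))%:E.
  by rewrite fineK// fin_num_measure.
have le1 (m : probability nat R) : fine (m I) <= 1.
  by rewrite -lee_fin -fin probability_le1.
have := le1 mu; have := le1 rho; have y0 : 0 <= fine (nu I) by rewrite fine_ge0.
move: (fin mu) (fin nu) (fin rho) y0.
set x := fine (mu I); set y := fine (nu I); set z := fine (rho I).
move=> -> -> -> y0 z1 x1; rewrite -!EFinB -!EFinM -!EFinD !lee_fin => out inn.
have [xy|yx] := leP x y; first by left.
have [zy|yz] := leP z y; first by right.
have Axy : 0 <= A * (x - y) by rewrite mulr_ge0// subr_ge0 ltW.
have Bzy : 0 <= B * (z - y) by rewrite mulr_ge0// subr_ge0 ltW.
exfalso; have [CAB|ABC] := leP C (A + B).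
  have y0' : 0 <= (A + B - C) * y by rewrite mulr_ge0 ?subr_ge0//.
  (* Vanishing would force [A = B = 0], against [0 < C <= A + B]. *)
  have : 0 < A * (x - y) + B * (z - y).
    rewrite lt_neqAle addr_ge0// andbT eq_sym paddr_eq0// !mulf_eq0 !subr_eq0.
    rewrite (gt_eqF yx) (gt_eqF yz) !orbF.
    by apply/negP => /andP[/eqP ? /eqP ?]; lra.
  lra.
have : 0 < (C - A - B) * (1 - y) by rewrite mulr_gt0; lra.
lra.
Qed.

(** * Lower semicontinuity of the probability of a varying set *)

(** Some finite partial sum at [x] already exceeds [w]. It is continuous in the parameter, and its
    finitely many indices remain in [S y] for [y] near [x]. *)
Lemma probability_lsc (R : realType) (mu : R -> probability nat R)
    (S : R -> set nat) (x w : R) :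
  (forall k, (fun y => fine (mu y [set k])) y @[y --> x]
               --> fine (mu x [set k])) ->
  (forall k, S x k -> \forall y \near x, S y k) ->
  w < fine (mu x (S x)) -> \forall y \near x, w < fine (mu y (S y)).
Proof.
move=> cmu oS; rewrite -lte_fin fineK ?fin_num_measure// mass_series => lt.
have [N ltN] : exists N, w < \sum_(0 <= k < N | k \in S x) fine (mu x [set k]).
  apply: contrapT => noN; move: lt; apply/negP; rewrite -leNgt.
  apply: lime_le; first exact: is_cvg_nneseries.
  apply: nearW => N; rewrite leNgt; apply/negP => lt; apply: noN; exists N.
  rewrite -lte_fin -sumEFin; apply: lt_le_trans lt _.
  by apply: lee_sum => k _; rewrite fineK// fin_num_measure.
have cvs : (fun y => \sum_(0 <= k < N | k \in S x) fine (mu y [set k])) y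
    @[y --> x] --> \sum_(0 <= k < N | k \in S x) fine (mu x [set k]).
  by apply: cvg_big => //; exact: add_continuous.
have nS : \forall y \near x, forall k : 'I_N, S x k -> S y k.
  have := @filter_forall R 'I_N (fun k y => S x k -> S y k) (nbhs x) _.
  apply=> k.
  by have [/oS|nSk] := pselect (S x k); [apply: filterS|apply: nearW].
near=> y.
have lty : w < \sum_(0 <= k < N | k \in S x) fine (mu y [set k]).
  by near: y; apply: (cvgr_gt _ cvs).
have Sxy : forall k : 'I_N, S x k -> S y k by near: y.
apply: lt_le_trans lty _.
rewrite -lee_fin fineK ?fin_num_measure// mass_series -sumEFin.
apply: le_trans (nneseries_lim_ge N _) => //.
rewrite big_mkcond [leRHS]big_mkcond !big_mkord; apply: lee_sum => k _.
rewrite fineK ?fin_num_measure//.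
case: ifPn => [/set_mem/Sxy/mem_set->//|_]; by case: ifP.
Unshelve. all: by end_near.
Qed.

(** * The negative binomial family *)

Lemma negative_binomial_pmf_cvg (R : realType) (r x : R) (k : nat) : 0 < x ->
  negative_binomial_pmf r y k @[y --> x] --> negative_binomial_pmf r x k.
Proof.
move=> x0; apply: cvgM; last first.
  apply: (@continuous_comp _ _ _ (fun y : R => 1 - y) (fun y => y ^+ k)).
    by apply: cvgB; [exact: cvg_cst|exact: cvg_id].
  exact: exprn_continuous.
apply: cvgM; first exact: cvg_cst.
have dpow : derivable (@powR R ^~ r) x 1 by case: (is_derive1_powR r x0).
by have /derivable1_diffP/differentiable_continuous := dpow.
Qed.

(** Up to the factor [p ^ r] and a coefficient independent of [p], the mass function is geometric
    with ratio [1 - p], so the separation of geometric sequences applies. *)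
Lemma negative_binomial_quasiconcave (R : realType) (r x y z : R)
    (mu nu rho : probability nat R) (I : set nat) :
  0 < x -> x < y -> y < z -> z < 1 ->
  (forall k, mu [set k] = (negative_binomial_pmf r x k)%:E) ->
  (forall k, nu [set k] = (negative_binomial_pmf r y k)%:E) ->
  (forall k, rho [set k] = (negative_binomial_pmf r z k)%:E) ->
  order_convex I ->
  (mu I <= nu I \/ rho I <= nu I)%E.
Proof.
move=> x0 xy yz z1 muE nuE rhoE cI.
have [||| A [B [A0 B0 inI outI]]] :=
  geometric_separation R (1 - x) (1 - y) (1 - z) I _ _ _ cI; [lra..|].
have xr : 0 < x `^ r by apply: powR_gt0.
have yr : 0 < y `^ r by apply: powR_gt0; lra.
have zr : 0 < z `^ r by apply: powR_gt0; lra.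
pose g k := gen_binomial (k%:R + r - 1) k.
(* The sign is read off from [nu]: its masses are nonnegative and the other factors positive. *)
have g0 k : 0 <= g k.
  have : (0 <= nu [set k])%E by [].
  rewrite nuE lee_fin /negative_binomial_pmf -/(g k) pmulr_lge0 ?pmulr_lge0//.
  by rewrite exprn_gt0//; lra.
have scale (D p : R) k : 0 < p `^ r ->
    (D / p `^ r) * negative_binomial_pmf r p k = g k * (D * (1 - p) ^+ k).
  by move=> p0; rewrite /negative_binomial_pmf -/(g k); field; lra.
apply: (min_probability_le _ _ _ _ _ (A / x `^ r) (B / z `^ r) (1 / y `^ r)).
- by rewrite divr_ge0// ltW.
- by rewrite divr_ge0// ltW.
- by rewrite divr_gt0.
- move=> k Ik; rewrite muE nuE rhoE -!EFinM -EFinD lee_fin !scale// -mulrDr.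
  by rewrite mul1r ler_wpM2l// inI.
- move=> k Ik; rewrite muE nuE rhoE -!EFinM -EFinD lee_fin !scale// -mulrDr.
  by rewrite mul1r ler_wpM2l// outI.
Qed.

(** * Interval structure of the covered indices, and values above a point *)

(** Each of [L] and [U] gets its bound at [j] from [i] or from [k], according to its own
    direction. *)
Lemma order_convex_between (R : realType) (L U : nat -> R) (p : R) :
  monotone_seq L -> monotone_seq U -> order_convex [set k | L k < p < U k].
Proof.
move=> mL mU i j k /andP[ij jk] /= /andP[Li Ui] /andP[Lk Uk].
apply/andP; split.
  by case: mL => mL; [apply: le_lt_trans Lk|apply: le_lt_trans Li]; apply: mL.
by case: mU => mU; [apply: lt_le_trans Ui _|apply: lt_le_trans Uk _]; apply: mU.
Qed.

Lemma monotone_first_above (R : realType) (u : nat -> R) (b p : R) :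
  monotone_seq u -> p <= b ->
  (forall k, p <= u k) \/
  exists q, [/\ p <= q <= b, q = b \/ exists k, q = u k &
                forall k, u k < q -> u k < p].
Proof.
move=> mu pb; pose v k := - u k.
have mv : monotone_seq v.
  by case: mu => mu; [right|left] => i j ij; rewrite lerN2; apply: mu.
have [|up|[q [/andP[bq qp] qE vq]]] := monotone_last_below R v (- b) (- p) mv.
- by rewrite lerN2.
- by left=> k; rewrite -lerN2; apply: up.
right; exists (- q); split.
- by rewrite lerNr qp lerNl.
- case: qE => [->|[k ->]]; first by left; rewrite opprK.
  by right; exists k; rewrite opprK.
- by move=> k; rewrite ltrNr => /vq; rewrite ltrN2.
Qed.

(** * Minimisation of the coverage *)

Theorem theorem5 (R : realType) (r : R) (hr : 0 < r)
    (d : measure_display) (T : measurableType d)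
    (P : R -> probability T R) (K : forall p : R, {RV (P p) >-> nat})
    (hK : forall p : R, 0 < p < 1 -> is_negative_binomial (K p) r p)
    (a b : R) (ha : 0 < a) (hab : a <= b) (hb : b < 1)
    (L U : nat -> R) (hL : monotone_seq L) (hU : monotone_seq U) :
  exists2 p0 : R,
    ([set a; b] `|` [set x | (exists k, x = L k) /\ a < x < b]
                `|` [set x | (exists k, x = U k) /\ a < x < b]) p0 &
    forall p : R, a <= p <= b ->
      (coverage (K p0) L U p0 <= coverage (K p) L U p)%E.
Proof.
set Q := (X in exists2 p0, X p0 & _).
pose mu (p : R) : probability nat R := distribution (P p) (K p).
pose S (p : R) := [set k | L k < p < U k].
have covE p : coverage (K p) L U p = mu p (S p) by [].
have muE p k : 0 < p < 1 -> mu p [set k] = (negative_binomial_pmf r p k)%:E.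
  by move=> p01; apply: hK.
have Q_of q : a <= q <= b ->
    q = a \/ q = b \/ (exists k, q = L k) \/ (exists k, q = U k) -> Q q.
  move=> /andP[aq qb] qE.
  have [->|qa] := eqVneq q a; first by left; left; left.
  have [->|qb'] := eqVneq q b; first by left; left; right.
  have aqb : a < q < b by rewrite !lt_neqAle aq qb eq_sym qa qb'.
  case: qE => [/eqP|[/eqP|[qL|qU]]]; rewrite ?(negbTE qa) ?(negbTE qb')//.
    by left; right.
  by right.
have [||p abp pmin] :=
  attains_min_segment R a b (fun p => fine (mu p (S p))) 0 hab.
- by move=> p; rewrite fine_ge0.
(* Points near [x] may leave [[a, b]] but stay in [(0, 1)], where the mass formula holds. *)
- move=> x w abx; apply: probability_lsc => [k|k /= /andP[Lx xU]].
    have x01 : 0 < x < 1 by lra.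
    rewrite muE//=; have := negative_binomial_pmf_cvg R r x k.
    rewrite (andP x01).1 => /(_ isT); apply: cvg_trans; apply: near_eq_cvg.
    near=> y; rewrite muE//.
    by apply/andP; split; near: y; [apply: lt_nbhsr|apply: lt_nbhsl]; lra.
  near=> y; apply/andP; split; near: y; [exact: lt_nbhsr|exact: lt_nbhsl].
have {}pmin y : a <= y <= b -> (mu p (S p) <= mu y (S y))%E.
  move=> /pmin; rewrite -lee_fin !fineK// fin_num_measure//.
(* The minimiser [p] may lie outside [Q]; it is traded for a point of [Q] with no larger
   coverage. *)
suff [q Qq qp] : exists2 q, Q q & (mu q (S q) <= mu p (S p))%E.
  by exists q => // y aby; rewrite !covE; apply: le_trans qp _; apply: pmin.
have /andP[ap pb] := abp.
have empty q : S q = set0 -> (mu q (S q) <= mu p (S p))%E.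
  by move=> ->; rewrite measure0.
have [Up|[q1 [/andP[aq1 q1p] Q1 hq1]]] := monotone_last_below R U a p hU ap.
  (* No value of [U] exceeds [p <= b], so the coverage vanishes at [b]. *)
  exists b; first by left; left; right.
  apply: empty; rewrite -subset0 => k /= /andP[_]; have := Up k; lra.
have [Lp|[q2 [/andP[pq2 q2b] Q2 hq2]]] := monotone_first_above R L b p hL pb.
  exists a; first by left; left; left.
  apply: empty; rewrite -subset0 => k /= /andP[+ _]; have := Lp k; lra.
have Qq1 : Q q1.
  by apply: Q_of; [lra|case: Q1 => [?|?]; [left|right; right; right]].
have Qq2 : Q q2.
  by apply: Q_of; [lra|case: Q2 => [?|?]; right; [left|right; left]].
have [<-|q1p'] := eqVneq q1 p; first by exists q1.
have [->|pq2'] := eqVneq p q2; first by exists q2.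
(* From [q1] to [p] the bound by [L] persists and no value of [U] is passed; [sub2] is the mirror
   image. *)
have sub1 : S q1 `<=` S p.
  move=> k /andP[Lq /hq1 pU]; apply/andP; split=> //; exact: lt_le_trans q1p.
have sub2 : S q2 `<=` S p.
  move=> k /andP[/hq2 Lp qU]; apply/andP; split=> //; exact: le_lt_trans qU.
have lq1 : q1 < p by rewrite lt_neqAle q1p'.
have lq2 : p < q2 by rewrite lt_neqAle pq2'.
have [||||||||h|h] := negative_binomial_quasiconcave R r q1 p q2
  (mu q1) (mu p) (mu q2) (S p).
- lra.
- by [].
- by [].
- lra.
- by move=> k; apply: muE; lra.
- by move=> k; apply: muE; lra.
- by move=> k; apply: muE; lra.
- exact: order_convex_between.
- exists q1 => //; apply: le_trans h.
  by apply: le_measure; rewrite ?inE.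
- exists q2 => //; apply: le_trans h.
  by apply: le_measure; rewrite ?inE.
Unshelve. all: by end_near.
Qed.
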